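(* Let $n$ be a positive integer and let $(\prec)\in\mathrm{WO}(\mathrm{TTot}_n)$. Then $(\prec)$ has a canonical join representation (in $\mathrm{WO}(\mathrm{TTot}_n)$) if and only if $(\prec)$ is widely generated. In this case, the canonical join representation of $(\prec)$ is $$\bigvee_{\widetilde{\mathfrak a}\in\widetilde{\mathrm{LowerArcs}}(\prec)}j_{\widetilde{\mathfrak a}}.$$
   Context: Fix $n\ge1$. A TITO is a (strict) total order $\prec$ on $\mathbb{Z}$ such that for all $a,b$: $a\prec b$ iff $a+n\prec b+n$; $\mathrm{TTot}_n$ is the set of TITOs. $<$ denotes the usual order. $\mathrm{WO}(\mathrm{TTot}_n)$ is $\mathrm{TTot}_n$ partially ordered by $(\prec_1)\le(\prec_2)$ iff every pair $(a,b)$ with $a<b$ and $b\prec_1 a$ also satisfies $b\prec_2 a$; it is a complete lattice. An arc is a tuple $(a,b,L,R)$ with $a<b$ integers and $L\sqcup R=\{a+1,\dots,b-1\}$. Two arcs $(a,b,L,R)$ and $(a',b',L',R')$ cross if $a=a'$, or $b=b'$, or both of the sets $(L\cap R')\cup(\{a,b\}\cap R')\cup(L\cap\{a',b'\})$ and $(R\cap L')\cup(\{a,b\}\cap L')\cup(R\cap\{a',b'\})$ are nonempty. A wrapped pre-arc is an equivalence class of arcs under the equivalence relation generated by $(a,b,L,R)\sim(a+n,b+n,L+n,R+n)$. A wrapped arc is a wrapped pre-arc no two distinct representatives of which cross. An arc $(a,b,L,R)$ is a lower arc of a total order $\prec$ if $b\prec a$ with no $c$ satisfying $b\prec c\prec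 a$, $\ell\prec b$ for all $\ell\in L$, and $a\prec r$ for all $r\in R$. A wrapped pre-arc is a lower arc of a TITO $\prec$ if a (equivalently, any) representative is a lower arc of $\prec$; $\widetilde{\mathrm{LowerArcs}}(\prec)$ is the set of these, all of which are wrapped arcs. An element $j$ of a complete lattice is a complete join-irreducible if there is no subset $X$ with $j\notin X$ and $\bigvee X=j$. Each complete join-irreducible of $\mathrm{WO}(\mathrm{TTot}_n)$ has exactly one lower arc, and for each wrapped arc $\widetilde{\mathfrak a}$ there is a unique complete join-irreducible of $\mathrm{WO}(\mathrm{TTot}_n)$ having $\widetilde{\mathfrak a}$ as a lower arc; it is denoted $j_{\widetilde{\mathfrak a}}$. An element $x$ of a poset is widely generated if for all $y<x$ there is a cover relation $x'\lessdot x$ with $y\le x'$. In a complete lattice $\Lambda$, for $U,V\subseteq \Lambda$ write $U\ll V$ if every $u\in U$ satisfies $u\le v$ for some $v\in V$. A join representation $x=\bigvee U$ is irredundant if no proper subset $U'\subsetneq U$ has $\bigvee U'=x$. It is the canonical join representation of $x$ if it is irredundant and $U\ll V$ for every $V\subseteq \Lambda$ with $\bigvee V=x$. *)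

(* Defs.v *)
From HB Require Import structures.
From Stdlib Require Import Relation_Operators.
From mathcomp Require Import all_boot all_order all_algebra.
From mathcomp Require Import boolp classical_sets.

Set Implicit Arguments.
Unset Strict Implicit.
Unset Printing Implicit Defensive.
Import Order.TTheory GRing.Theory Num.Theory.
Local Open Scope classical_set_scope.
Local Open Scope ring_scope.

(* Joins are relational: [supremums U x] says that x is the least upper bound
   of U, i.e. that x is the join of U. In particular [supremums set0 x] says
   that x is the bottom element. *)
Section Lattice.
Context {d : Order.disp_t} {T : porderType d}.
Implicit Types (x y j : T) (U V X : set T).

Definition covered_by y x := (y < x)%O /\ ~ exists z, (y < z < x)%O.

Definition complete_join_irreducible j :=
  ~ exists2 X, ~ X j & supremums X j.

Definition widely_generated x :=
  forall y, (y < x)%O -> exists2 x', covered_by x' x & (y <= x')%O.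

Definition join_refines U V := forall u, U u -> exists2 v, V v & (u <= v)%O.

Definition irredundant_join_rep x U :=
  supremums U x /\ forall U', U' `<` U -> ~ supremums U' x.

Definition canonical_join_rep x U :=
  irredundant_join_rep x U /\ forall V, supremums V x -> join_refines U V.

End Lattice.

Record TITO (n : nat) := MkTITO {
  tito_rel :> rel int ;
  tito_irr : irreflexive tito_rel ;
  tito_trans : transitive tito_rel ;
  tito_total : forall a b, a != b -> tito_rel a b || tito_rel b a ;
  tito_shift : forall a b, tito_rel a b = tito_rel (a + n%:Z) (b + n%:Z)
}.

HB.instance Definition _ n := gen_eqMixin (TITO n).
HB.instance Definition _ n := gen_choiceMixin (TITO n).

Lemma tito_asym n (x : TITO n) a b : x a b -> x b a = false.
Proof.
by move=> xab; apply/negP => /(tito_trans xab); rewrite tito_irr.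
Qed.

Lemma tito_inj n (x y : TITO n) : x =2 y -> x = y.
Proof.
case: x y => [r p1 p2 p3 p4] [s q1 q2 q3 q4] /= rs.
have {}rs : r = s by apply/funext => a; apply/funext => b.
subst s; by congr MkTITO; exact: Prop_irrelevance.
Qed.

Definition wo_le n (x y : TITO n) : bool :=
  `[< forall a b : int, a < b -> x b a -> y b a >].

Lemma wo_le_refl n : reflexive (@wo_le n).
Proof. by move=> x; apply/asboolP. Qed.

Lemma wo_le_trans n : transitive (@wo_le n).
Proof.
move=> y x z /asboolP xy /asboolP yz; apply/asboolP => a b ab xba.
exact/yz/xy.
Qed.

Lemma wo_le_anti n : antisymmetric (@wo_le n).
Proof.
move=> x y /andP[/asboolP xy /asboolP yx].
have inv (a b : int) : a < b -> x b a = y b a.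
  by move=> ab; apply/idP/idP; [exact: xy | exact: yx].
have xN (z : TITO n) a b : a != b -> z a b = ~~ z b a.
  move=> ab; have := tito_total z ab; case zab: (z a b) => /=.
    by rewrite (tito_asym zab).
  by move->.
apply: tito_inj => a b; have [ab|ab|->] := ltgtP a b.
- by rewrite !(xN _ a b) ?lt_eqF// inv.
- exact: inv.
- by rewrite !tito_irr.
Qed.

Fact wo_display : Order.disp_t. Proof. exact: Order.Disp tt tt. Qed.

(* WO(TTot_n) *)
HB.instance Definition _ n := Order.Le_isPOrder.Build wo_display (TITO n)
  (@wo_le_refl n) (@wo_le_anti n) (@wo_le_trans n).

Lemma leEwo n (x y : TITO n) :
  (x <= y)%O <-> forall a b : int, a < b -> x b a -> y b a.
Proof. by split=> [/asboolP|?]; [|apply/asboolP]. Qed.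

Record arc := Arc {
  arc_a : int ;
  arc_b : int ;
  arc_L : set int ;
  arc_R : set int ;
  arc_lt : arc_a < arc_b ;
  arc_disj : arc_L `&` arc_R = set0 ;
  arc_cover : arc_L `|` arc_R = [set c | arc_a < c < arc_b]
}.

Definition cross (u v : arc) : Prop :=
  let: (a, b, L, R) := (arc_a u, arc_b u, arc_L u, arc_R u) in
  let: (a', b', L', R') := (arc_a v, arc_b v, arc_L v, arc_R v) in
  [\/ a = a', b = b' |
    (L `&` R' `|` [set a; b] `&` R' `|` L `&` [set a'; b']) !=set0 /\
    (R `&` L' `|` [set a; b] `&` L' `|` R `&` [set a'; b']) !=set0].

Definition arc_translate (n : nat) (u v : arc) : Prop :=
  [/\ arc_a v = arc_a u + n%:Z, arc_b v = arc_b u + n%:Z,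
      arc_L v = [set l + n%:Z | l in arc_L u] &
      arc_R v = [set r + n%:Z | r in arc_R u]].

Definition arc_equiv (n : nat) : arc -> arc -> Prop :=
  clos_refl_sym_trans arc (arc_translate n).

(* A wrapped pre-arc is an equivalence class of arcs, as a set of arcs. *)
Record wrapped_prearc (n : nat) := WrappedPrearc {
  representatives : set arc ;
  representativesP : exists u, representatives = [set v | arc_equiv n u v]
}.

Definition is_wrapped_arc n (A : wrapped_prearc n) :=
  forall u v, representatives A u -> representatives A v -> u <> v ->
    ~ cross u v.

Record wrapped_arc (n : nat) := WrappedArc {
  wrapped_arc_val :> wrapped_prearc n ;
  wrapped_arcP : is_wrapped_arc wrapped_arc_val
}.

Definition lower_arc (r : rel int) (u : arc) : Prop :=
  [/\ r (arc_b u) (arc_a u),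
      ~ (exists c, r (arc_b u) c /\ r c (arc_a u)),
      forall l, arc_L u l -> r l (arc_b u) &
      forall c, arc_R u c -> r (arc_a u) c].

Definition wrapped_lower_arc n (x : TITO n) (A : wrapped_prearc n) : Prop :=
  exists2 u, representatives A u & lower_arc x u.

Lemma lower_arc_translate n (x : TITO n) u v :
  arc_translate n u v -> lower_arc x u <-> lower_arc x v.
Proof.
rewrite /lower_arc => -[-> -> -> ->]; split.
- move=> [xba nc xL xR]; split.
  + by rewrite -tito_shift.
  + move=> [c []]; rewrite -(subrK n%:Z c) -!tito_shift => bc ca.
    by apply: nc; exists (c - n%:Z).
  + by move=> _ [l Ll <-]; rewrite -tito_shift xL.
  + by move=> _ [c Rc <-]; rewrite -tito_shift xR.
- move=> [xba nc xL xR]; split.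
  + by rewrite tito_shift.
  + move=> [c []]; rewrite tito_shift [x c _]tito_shift => bc ca.
    by apply: nc; exists (c + n%:Z).
  + by move=> l Ll; rewrite tito_shift; apply: xL; exists l.
  + by move=> c Rc; rewrite tito_shift; apply: xR; exists c.
Qed.

Lemma lower_arc_equiv n (x : TITO n) u v :
  arc_equiv n u v -> lower_arc x u <-> lower_arc x v.
Proof.
elim=> {u v} [u v|u|u v _ ih|u v w _ ih1 _ ih2].
- exact: lower_arc_translate.
- by [].
- by symmetry.
- by rewrite ih1.
Qed.

Lemma wrapped_lower_arc_all n (x : TITO n) (A : wrapped_prearc n) :
  wrapped_lower_arc x A <->
    forall u, representatives A u -> lower_arc x u.
Proof.
rewrite /wrapped_lower_arc; have [u ->] := representativesP A.
split => [[v uv xv] w uw|].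
  by apply/(lower_arc_equiv x uw)/(lower_arc_equiv x uv).
by move=> /(_ u) xu; exists u; [|apply: xu]; exact: rst_refl.
Qed.

Lemma arc_eq u v : arc_a u = arc_a v -> arc_b u = arc_b v ->
  arc_L u = arc_L v -> arc_R u = arc_R v -> u = v.
Proof.
case: u v => [a b L R p1 p2 p3] [a' b' L' R' q1 q2 q3] /= ? ? ? ?; subst.
by congr Arc; exact: Prop_irrelevance.
Qed.

Lemma lower_arc_inj n (x : TITO n) u v : lower_arc x u -> lower_arc x v ->
  arc_a u = arc_a v -> arc_b u = arc_b v -> u = v.
Proof.
move=> xu xv ab bb.
have sub w t : lower_arc x w -> lower_arc x t ->
    arc_a w = arc_a t -> arc_b w = arc_b t ->
    arc_L w `<=` arc_L t /\ arc_R w `<=` arc_R t.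
  move=> [xba _ wL wR] [_ _ tL tR] ea eb; split=> c wc.
    have : (arc_L t `|` arc_R t) c.
      by rewrite arc_cover -ea -eb -arc_cover; left.
    case=> // /tR; rewrite -ea => ac.
    have := tito_trans ac (tito_trans (wL _ wc) xba).
    by rewrite tito_irr.
  have : (arc_L t `|` arc_R t) c.
    by rewrite arc_cover -ea -eb -arc_cover; right.
  case=> // /tL; rewrite -eb => cb.
  have := tito_trans (wR _ wc) (tito_trans cb xba).
  by rewrite tito_irr.
have [L1 R1] := sub _ _ xu xv ab bb.
have [L2 R2] := sub _ _ xv xu (esym ab) (esym bb).
by apply: arc_eq => //; apply/seteqP.
Qed.

Lemma lower_arc_cross n (x : TITO n) u v : lower_arc x u -> lower_arc x v ->
  u <> v -> ~ cross u v.
Proof.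
have adj w t : lower_arc x w -> lower_arc x t ->
    arc_a w = arc_a t -> arc_b w = arc_b t.
  move=> [ba nc _ _] [ba' nc' _ _] ea; apply/eqP/negPn/negP.
  move=> /(tito_total x)/orP[h|h].
  - by apply: nc; exists (arc_b t); rewrite ea.
  - by apply: nc'; exists (arc_b w); rewrite -ea.
have adj' w t : lower_arc x w -> lower_arc x t ->
    arc_b w = arc_b t -> arc_a w = arc_a t.
  move=> [ba nc _ _] [ba' nc' _ _] eb; apply/eqP/negPn/negP.
  move=> /(tito_total x)/orP[h|h].
  - by apply: nc'; exists (arc_a w); rewrite -eb.
  - by apply: nc; exists (arc_a t); rewrite eb.
have side w t p : lower_arc x w -> lower_arc x t ->
    [\/ arc_L w p /\ arc_R t p,
        [set arc_a w; arc_b w] p /\ arc_R t p |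
        arc_L w p /\ [set arc_a t; arc_b t] p] -> ~ x (arc_b w) (arc_a t).
  move=> [ba nc wL wR] [ba' nc' tL tR] + h.
  have F q : x q q -> False by rewrite tito_irr.
  case=> [[/wL h1 /tR h2]|[[->|->] /tR h2]|[/wL h1 [e|e]]].
  - exact: F (tito_trans h1 (tito_trans h h2)).
  - by apply: nc; exists (arc_a t).
  - exact: F (tito_trans h h2).
  - by move: h1; rewrite e => /(tito_trans h)/F.
  - by move: h1; rewrite e => h1; apply: nc'; exists (arc_b w).
move=> xu xv uv [e|e|[[p up] [q vq]]].
- by apply/uv/(lower_arc_inj xu xv) => //; exact: adj.
- by apply/uv/(lower_arc_inj xu xv) => //; exact: adj'.
have h1 : ~ x (arc_b u) (arc_a v).
  apply: (side _ _ p xu xv).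
  by case: up => [[[? ?]|[? ?]]|[? ?]]; [constructor 1|constructor 2|constructor 3].
have h2 : ~ x (arc_b v) (arc_a u).
  apply: (side _ _ q xv xu).
  by case: vq => [[[? ?]|[? ?]]|[? ?]]; [constructor 1|constructor 3|constructor 2].
case: xu xv => [ba _ _ _] [ba' _ _ _].
have [e|/(tito_total x)/orP[//|h]] := eqVneq (arc_b u) (arc_a v).
  by apply: h2; rewrite e in ba; exact: tito_trans ba' ba.
by apply: h2; exact: tito_trans (tito_trans ba' h) ba.
Qed.

Lemma wrapped_lower_arc_wrapped n (x : TITO n) (A : wrapped_prearc n) :
  wrapped_lower_arc x A -> is_wrapped_arc A.
Proof.
move=> /wrapped_lower_arc_all xA u v Au Av.
by apply: lower_arc_cross; exact: xA.
Qed.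

(* By [wrapped_lower_arc_wrapped], restricting to wrapped arcs here loses no
   wrapped pre-arc that is a lower arc of x. *)
Definition LowerArcs n (x : TITO n) : set (wrapped_arc n) :=
  [set A | wrapped_lower_arc x A].

Definition tito_std (n : nat) : TITO n.
Proof.
exists (fun a b : int => a < b).
- by move=> a; exact: ltxx.
- by move=> b a c; exact: lt_trans.
- by move=> a b; rewrite neq_lt.
- by move=> a b; rewrite ltrD2r.
Defined.

(* j_A: for n >= 1 there is exactly one such element; [tito_std] is the
   default value required by [xget] and plays no role. *)
Definition join_irr_of n (A : wrapped_arc n) : TITO n :=
  xget (tito_std n)
    [set j | complete_join_irreducible j /\ LowerArcs j A].

(* Main.v *)
(* TITOs correspond to inversion sets, i.e. n-periodic transitive and
   cotransitive relations contained in <; the transitive closure of a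
   cotransitive relation is cotransitive, so the inversions of a join are the
   transitive closure of the union, and an inversion (a, b) with b, a adjacent
   in the join must already be an inversion of a joinand.

   For an arc (a, b, L, R), the pairs (p, q), p in {a} u R, q in {b} u L, and
   their translates form a cotransitive relation, whose closure is the
   inversion set of the least TITO with L before b before a before R. In that
   TITO b and a turn out to be adjacent, so it is the complete join-irreducible
   of the arc, and it lies below every y <= x that inverts (a, b) whenever the
   arc is a lower arc of x.

   If w does not lie above x, an inversion (a, b) of x that is not one of w
   and has b - a minimal spans an arc compatible with x; if w is a lower cover,
   joining w with the least TITO of this arc gives x, which forces b and a to
   be adjacent in x. *)
From mathcomp Require Import all_boot all_order all_algebra.
From mathcomp Require Import boolp classical_sets.
From Stdlib Require Import Relation_Operators.
From mathcomp Require Import zify.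
Require Import Defs.
Import Order.TTheory GRing.Theory Num.Theory.
Set Implicit Arguments.
Unset Strict Implicit.
Unset Printing Implicit Defensive.
Local Open Scope classical_set_scope.
Local Open Scope ring_scope.

(** * Inversions and the weak order *)

Definition inversion {n : nat} (x : TITO n) (a b : int) : Prop := a < b /\ x b a.

Lemma le_inversion {n : nat} (x y : TITO n) :
  (x <= y)%O <-> forall a b, inversion x a b -> inversion y a b.
Proof.
rewrite leEwo; split=> xy a b; first by case=> ab /(xy _ _ ab).
by move=> ab xba; case: (xy a b).
Qed.

Lemma inversion_trans {n : nat} (x : TITO n) (b a c : int) :
  inversion x a b -> inversion x b c -> inversion x a c.
Proof.
move=> [ab xba] [bc xcb]; split; first exact: lt_trans bc.
exact: tito_trans xba.
Qed.

Lemma not_inversion {n : nat} (x : TITO n) (a b : int) :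
  a < b -> ~ inversion x a b -> x a b.
Proof.
move=> ab xab; have /(tito_total x)/orP[//|xba] : a != b by rewrite lt_eqF.
by case: xab.
Qed.

Lemma tito_cycle {n : nat} (x : TITO n) (a b : int) : x a b -> x b a -> False.
Proof. by move=> /tito_asym ->. Qed.

Lemma tito_le_mono {n : nat} (x y : TITO n) (a b : int) :
  (x <= y)%O -> a < b -> y a b -> x a b.
Proof.
move=> /le_inversion xy ab yab; apply: not_inversion => // /xy[_].
exact: tito_cycle.
Qed.

Lemma tito_shift_mul {n : nat} (x : TITO n) (a b k : int) :
  x (a + k * n%:Z) (b + k * n%:Z) = x a b.
Proof.
have shift_nat m c d : x (c + m%:Z * n%:Z) (d + m%:Z * n%:Z) = x c d.
  elim: m => [|m IHm]; first by rewrite mul0r !addr0.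
  by rewrite -addn1 PoszD mulrDl mul1r !addrA -tito_shift IHm.
case: (intP k) => [|m|m]; rewrite ?mul0r ?addr0 //.
by rewrite -(shift_nat m.+1) mulNr !subrK.
Qed.

(** * TITOs built from inversion sets *)

Definition cotransitive (C : int -> int -> Prop) : Prop :=
  forall a b c, a < b -> b < c -> C a c -> C a b \/ C b c.

Definition increasing (C : int -> int -> Prop) : Prop :=
  forall a b, C a b -> a < b.

Definition periodic (n : nat) (C : int -> int -> Prop) : Prop :=
  forall a b, C a b <-> C (a + n%:Z) (b + n%:Z).

(** The order [r] reverses exactly the pairs in [I]. Its transitivity is cotransitivity of [I] when
    both pairs are kept, transitivity when both are reversed, and a mix of the two otherwise. *)
Lemma tito_of_inversions (n : nat) (I : int -> int -> Prop) :
  increasing I -> cotransitive I -> periodic n I ->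
  (forall a b c, I a b -> I b c -> I a c) ->
  exists x : TITO n, forall a b, inversion x a b <-> I a b.
Proof.
move=> Ilt Ico Ish Itr.
pose r : rel int := fun a b => `[< (a < b /\ ~ I a b) \/ I b a >].
have r_irr : irreflexive r.
  move=> a; apply/negP => /asboolP [[]|/Ilt]; by rewrite ltxx.
have r_trans : transitive r.
  move=> y x z /asboolP xy /asboolP yz; apply/asboolP.
  case: xy yz => [[xy nIxy]|Iyx] [[yz nIyz]|Izy].
  - by left; split; [lia | case/(Ico _ _ _ xy yz)].
  - have zy := Ilt _ _ Izy; have [xz|zx|e] := ltgtP x z.
    + by left; split=> // Ixz; apply/nIxy/Itr/Izy.
    + by right; case: (Ico _ _ _ zx xy Izy).
    + by subst z.
  - have yx := Ilt _ _ Iyx; have [xz|zx|e] := ltgtP x z.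
    + by left; split=> // Ixz; apply/nIyz/Itr/Ixz.
    + by right; case: (Ico _ _ _ yz zx Iyx).
    + by subst z.
  - by right; exact: Itr Iyx.
have r_total a b : a != b -> r a b || r b a.
  wlog ab : a b / a < b => [H ne|_].
    have [/H->//|/H|/eqP] := ltgtP a b; last by rewrite (negbTE ne).
    by rewrite orbC eq_sym; exact.
  have [Iab|nIab] := pselect (I a b).
    by apply/orP; right; apply/asboolP; right.
  by apply/orP; left; apply/asboolP; left.
have r_shift a b : r a b = r (a + n%:Z) (b + n%:Z).
  by apply/asboolP/asboolP; rewrite -!Ish ltrD2r.
exists (MkTITO r_irr r_trans r_total r_shift) => a b; split.
  by move=> [ab /asboolP[[]|//]]; lia.
by move=> Iab; split; [exact: Ilt | apply/asboolP; right].
Qed.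

(** Split a chain at a junction [m]: the new point lies within one of the two halves, or equals
    [m]. *)
Lemma clos_trans_cotransitive (C : int -> int -> Prop) :
  cotransitive C -> cotransitive (clos_trans int C).
Proof.
move=> Cco a b c; move=> + + Cac; move: Cac b; elim=> {a c}.
  by move=> a c Cac b ab bc; case: (Cco _ _ _ ab bc Cac); [left|right]; apply: t_step.
move=> a m c Cam IHam Cmc IHmc b ab bc; have [bm|mb|e] := ltgtP b m.
- by case: (IHam b) => // h; [left|right; apply: t_trans Cmc].
- by case: (IHmc b) => // h; [left; apply: t_trans h|right].
- by left; rewrite e.
Qed.

Lemma tito_of_closure (n : nat) (C : int -> int -> Prop) :
  increasing C -> cotransitive C -> periodic n C ->
  exists x : TITO n, forall a b, inversion x a b <-> clos_trans int C a b.
Proof.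
move=> Clt Cco Csh; apply: tito_of_inversions.
- by move=> a b; elim=> [{}a {}b /Clt//|{}a m {}b _ am _ mb]; exact: lt_trans mb.
- exact: clos_trans_cotransitive.
- have sh (t : int) a b : (forall c d, C c d -> C (c + t) (d + t)) ->
      clos_trans int C a b -> clos_trans int C (a + t) (b + t).
    by move=> H; elim=> [{}a {}b /H|{}a m {}b _ am _]; [exact: t_step|exact: t_trans].
  move=> a b; split; first by apply: sh => c d /Csh.
  move=> /(sh (- n%:Z)); rewrite !addrK; apply => c d Ccd.
  by apply/Csh; rewrite !subrK.
- by move=> a b c; exact: t_trans.
Qed.

Lemma clos_trans_inversion {n : nat} (x : TITO n) (C : int -> int -> Prop) :
  (forall a b, C a b -> inversion x a b) ->
  forall a b, clos_trans int C a b -> inversion x a b.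
Proof. by move=> Cx a b; elim=> // ? m ? _ + _; exact: inversion_trans. Qed.

(* The step at which a chain jumps over [d]. *)
Lemma clos_trans_jump (C : int -> int -> Prop) (a b d : int) :
  clos_trans int C a b -> a <= d < b ->
  exists p q, [/\ C p q, p <= d < q, p = a \/ clos_trans int C a p
                & q = b \/ clos_trans int C q b].
Proof.
elim=> {a b} [a b Cab abd|a m b Cam IHam Cmb IHmb /andP[ad db]].
  by exists a, b; split=> //; left.
have [dm|md] := ltP d m.
  have [|p [q [Cpq pq pa qm]]] := IHam; first by rewrite ad.
  exists p, q; split=> //; right; case: qm => [->//|qm]; exact: t_trans Cmb.
have [|p [q [Cpq pq pa qm]]] := IHmb; first by rewrite md.
exists p, q; split=> //; right; case: pa => [->//|mp]; exact: t_trans mp.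
Qed.

(** * Adjacent elements and inversions of joins *)

Definition tito_adjacent {n : nat} (x : TITO n) (b a : int) : Prop :=
  x b a /\ ~ exists c, x b c /\ x c a.

(** A junction of a longer chain would lie between [b] and [a] in [x]. *)
Lemma clos_trans_adjacent {n : nat} (x : TITO n) (C : int -> int -> Prop) (a b : int) :
  (forall p q, C p q -> inversion x p q) -> tito_adjacent x b a ->
  clos_trans int C a b -> C a b.
Proof.
move=> /clos_trans_inversion Cx + Cab; case: Cab => [//|m {}b am mb [_ []]].
by exists m; split; [case: (Cx _ _ mb) | case: (Cx _ _ am)].
Qed.

Definition join_inversion {n : nat} (X : set (TITO n)) (a b : int) : Prop :=
  exists2 y, X y & inversion y a b.

(** A union of inversion sets is cotransitive, and every upper bound, having transitive inversions,
    contains its closure. *)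
Lemma exists_sup {n : nat} (X : set (TITO n)) :
  exists2 x, supremums X x &
    forall a b, inversion x a b <-> clos_trans int (join_inversion X) a b.
Proof.
have [|||x xP] := @tito_of_closure n (join_inversion X).
- by move=> a b [y _ []].
- move=> a b c ab bc [y Xy [ac yca]].
  have [|yab] := pselect (inversion y a b); first by left; exists y.
  right; exists y => //; split=> //.
  exact: tito_trans yca (not_inversion ab yab).
- move=> a b; split=> -[y Xy [ab yba]]; exists y => //; split.
  + by rewrite ltrD2r.
  + by rewrite -tito_shift.
  + by move: ab; rewrite ltrD2r.
  + by rewrite tito_shift.
exists x => //; split.
  by move=> y Xy; apply/le_inversion => a b yab; apply/xP/t_step; exists y.
move=> z Xz; apply/le_inversion => a b /xP.
apply: clos_trans_inversion => {}a {}b [y /Xz/le_inversion yz]; exact: yz.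
Qed.

Lemma sup_inversion {n : nat} (X : set (TITO n)) (x : TITO n) (a b : int) :
  supremums X x -> inversion x a b -> clos_trans int (join_inversion X) a b.
Proof.
have [y [Xy yX] yP] := exists_sup X; move=> [Xx xX].
suff -> : x = y by move/yP.
by apply: le_anti; rewrite xX// yX.
Qed.

(** * Arcs compatible with a TITO *)

Lemma arc_LE (u : arc) (c : int) : arc_L u c -> arc_a u < c < arc_b u.
Proof.
move=> Lc; have : (arc_L u `|` arc_R u) c by left.
by rewrite arc_cover.
Qed.

Lemma arc_RE (u : arc) (c : int) : arc_R u c -> arc_a u < c < arc_b u.
Proof.
move=> Rc; have : (arc_L u `|` arc_R u) c by right.
by rewrite arc_cover.
Qed.

Lemma arc_LR (u : arc) (c : int) : arc_a u < c < arc_b u -> arc_L u c \/ arc_R u c.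
Proof. by move=> uc; change ((arc_L u `|` arc_R u) c); rewrite arc_cover. Qed.

(** A lower arc stripped of its adjacency condition. *)
Definition fits (u : arc) {n : nat} (x : TITO n) : Prop :=
  [/\ x (arc_b u) (arc_a u), forall l, arc_L u l -> x l (arc_b u)
    & forall r, arc_R u r -> x (arc_a u) r].

Lemma lower_arcE {n : nat} (x : TITO n) (u : arc) :
  lower_arc x u <-> fits u x /\ tito_adjacent x (arc_b u) (arc_a u).
Proof. by split=> [[? ? ? ?]|[[? ? ?] [? ?]]]. Qed.

Lemma fits_le {n : nat} (x y : TITO n) (u : arc) :
  (y <= x)%O -> fits u x -> inversion y (arc_a u) (arc_b u) -> fits u y.
Proof.
move=> yx [_ uL uR] [_ yba]; split=> // c uc.
  by apply: (tito_le_mono yx); [case/andP: (arc_LE uc)|exact: uL].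
by apply: (tito_le_mono yx); [case/andP: (arc_RE uc)|exact: uR].
Qed.

(* The inversions forced, up to translation, on every TITO that fits [u]. *)
Definition arc_step (n : nat) (u : arc) (p q : int) : Prop :=
  p < q /\ exists k p0 q0, [/\ p = p0 + k * n%:Z, q = q0 + k * n%:Z,
    p0 = arc_a u \/ arc_R u p0 & q0 = arc_b u \/ arc_L u q0].

Lemma arc_step_inversion {n : nat} (x : TITO n) (u : arc) (p q : int) :
  fits u x -> arc_step n u p q -> inversion x p q.
Proof.
move=> [xba xL xR] [pq [k [p0 [q0 [ep eq up uq]]]]]; split=> //.
rewrite ep eq tito_shift_mul.
have xbp : x (arc_b u) p0.
  by case: up => [->//|/xR]; exact: tito_trans.
case: uq => [->//|/xL xqb]; exact: tito_trans xbp.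
Qed.

(** The middle point, translated back, falls in [L] and can end a step, or in [R] and can start
    one. *)
Lemma arc_step_cotransitive (n : nat) (u : arc) : cotransitive (arc_step n u).
Proof.
move=> p m q pm mq [pq [k [p0 [q0 [ep eq up uq]]]]].
have em : m = (m - k * n%:Z) + k * n%:Z by rewrite subrK.
have [Lm|Rm] : arc_L u (m - k * n%:Z) \/ arc_R u (m - k * n%:Z).
  apply: arc_LR; have := arc_lt u.
  by case: up => [?|/arc_RE/andP[? ?]]; case: uq => [?|/arc_LE/andP[? ?]]; lia.
- by left; split=> //; exists k, p0, (m - k * n%:Z); split=> //; right.
- by right; split=> //; exists k, (m - k * n%:Z), q0; split=> //; right.
Qed.

Lemma arc_step_periodic (n : nat) (u : arc) : periodic n (arc_step n u).
Proof.
move=> p q; split=> -[pq [k [p0 [q0 [ep eq up uq]]]]]; (split; first by lia).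
  by exists (k + 1), p0, q0; split=> //; rewrite mulrDl mul1r addrA -?ep -?eq.
by exists (k - 1), p0, q0; split=> //; rewrite mulrBl mul1r; lia.
Qed.

Lemma arc_step_endpoints (n : nat) (u : arc) : arc_step n u (arc_a u) (arc_b u).
Proof.
split; first exact: arc_lt.
by exists 0, (arc_a u), (arc_b u); rewrite mul0r !addr0; split=> //; left.
Qed.

(** * The least TITO compatible with an arc *)

Definition minimal_fit (u : arc) {n : nat} (j : TITO n) : Prop :=
  fits u j /\ forall y : TITO n, fits u y -> (j <= y)%O.

(** The closure of [arc_step] lies below [x], which forces it to keep [L] before [b] and [a] before
    [R]. *)
Lemma exists_minimal_fit {n : nat} (x : TITO n) (u : arc) :
  fits u x -> exists2 j : TITO n, minimal_fit u j &
    forall p q, inversion j p q <-> clos_trans int (arc_step n u) p q.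
Proof.
move=> ux; have [p q []//|||j jP] := @tito_of_closure n (arc_step n u).
- exact: arc_step_cotransitive.
- exact: arc_step_periodic.
have j_le y : fits u y -> (j <= y)%O.
  move=> uy; apply/le_inversion => p q /jP.
  by apply: clos_trans_inversion => {}p {}q; exact: arc_step_inversion.
exists j => //; split=> //; apply: (fits_le (j_le _ ux)) => //.
by apply/jP/t_step/arc_step_endpoints.
Qed.

Lemma minimal_fit_uniq (u : arc) {n : nat} (j k : TITO n) :
  minimal_fit u j -> minimal_fit u k -> j = k.
Proof. by move=> [uj jP] [uk kP]; apply: le_anti; rewrite jP// kP. Qed.

Lemma minimal_fit_inversion (u : arc) {n : nat} (j : TITO n) (p q : int) :
  minimal_fit u j -> inversion j p q -> clos_trans int (arc_step n u) p q.
Proof.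
move=> uj; have [k uk kP] := exists_minimal_fit uj.1.
by rewrite (minimal_fit_uniq uj uk) => /kP.
Qed.

(** Let [e] lie between [b] and [a] in [j]; the choice of [L] and [R] excludes [a < e < b]. If
    [b < e], look at the step from [p] to [q], a translate by [t], with which a chain from [a] to
    [e] jumps over [b]. If [b - t] is in [R], a chain leads from [b] to [e], so [e] precedes [b]; if
    it is in [L], then [a < p < b] and [p] lies between [b] and [a] in [j]. The case [e < a] is
    dual. *)
Lemma minimal_fit_lower_arc (u : arc) {n : nat} (j : TITO n) :
  minimal_fit u j -> lower_arc j u.
Proof.
move=> uj; have [[jba jL jR] _] := uj; split=> // -[e [jbe jea]].
have TCj p q : clos_trans int (arc_step n u) p q -> j q p.
  move=> pq; suff [] : inversion j p q by [].
  by apply: clos_trans_inversion pq => {}p {}q; exact: arc_step_inversion uj.1.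
have between c : arc_a u < c < arc_b u -> j (arc_b u) c -> j c (arc_a u) -> False.
  by move=> /arc_LR[/jL cb bc _|/jR ac _]; [exact: tito_cycle bc | exact: tito_cycle ac].
have ab := arc_lt u.
have [eb|be|?] := ltgtP e (arc_b u); last first.
- by subst e; move: jbe; rewrite tito_irr.
- have nTC : ~ clos_trans int (arc_step n u) (arc_b u) e.
    by move=> /TCj; exact: tito_cycle.
  have /(minimal_fit_inversion uj)/clos_trans_jump : inversion j (arc_a u) e.
    by split=> //; exact: lt_trans be.
  move=> /(_ (arc_b u)); rewrite be ltW// => -[//|p [q [pq /andP[pb bq] ap qe]]].
  have bqF : ~ arc_step n u (arc_b u) q.
    move=> /(@t_step _ _ _ _) bq'; apply: nTC.
    by case: qe => [<-//|]; exact: t_trans.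
  move: pb; rewrite le_eqVlt => /orP[/eqP pb|pb]; first by rewrite pb in pq.
  case: pq => _ [k [p0 [q0 [ep eq up uq]]]].
  set t := k * n%:Z in ep eq.
  have p0b : p0 < arc_b u - t < q0 by lia.
  have /arc_LR[Lb|Rb] : arc_a u < arc_b u - t < arc_b u.
    by case: up => [?|/arc_RE/andP[? ?]]; case: uq => [?|/arc_LE/andP[? ?]]; lia.
  + have jbp : j (arc_b u) p.
      have := jL _ Lb; rewrite -(tito_shift_mul _ _ _ k) -/t subrK => jbb.
      apply: tito_trans jbb _; rewrite ep tito_shift_mul.
      by case: up => [->//|/jR]; exact: tito_trans.
    have /andP[_ t_gt0] := arc_LE Lb.
    case: ap => [pa|/TCj jpa].
      by case: up => [?|/arc_RE/andP[? ?]]; lia.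
    apply: (between p) => //; rewrite pb andbT.
    by case: up => [?|/arc_RE/andP[? ?]]; lia.
  + apply: bqF; split=> //; exists k, (arc_b u - t), q0; split=> //; last by right.
    by rewrite subrK.
- have [ea|ae|?] := ltgtP e (arc_a u); last first.
  + by subst e; move: jea; rewrite tito_irr.
  + by apply: (between e) => //; rewrite ae.
  have nTC : ~ clos_trans int (arc_step n u) e (arc_a u).
    by move=> /TCj; exact: tito_cycle.
  have /(minimal_fit_inversion uj)/clos_trans_jump : inversion j e (arc_b u).
    by split=> //; exact: lt_trans ab.
  (* Jumping over [a - 1] means [p < a <= q], so the end of the step may be [a] itself. *)
  move=> /(_ (arc_a u - 1)) [|p [q [pq /andP[pa aq] ep qb]]]; first by lia.
  have paF : ~ arc_step n u p (arc_a u).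
    move=> /(@t_step _ _ _ _) pa'; apply: nTC.
    by case: ep => [<-//|ep]; exact: t_trans pa'.
  have [qa|{}aq] : q = arc_a u \/ arc_a u < q by lia.
    by rewrite qa in pq.
  case: pq => _ [k [p0 [q0 [epp eq up uq]]]].
  set t := k * n%:Z in epp eq.
  have p0a : p0 < arc_a u - t < q0 by lia.
  have /arc_LR[La|Ra] : arc_a u < arc_a u - t < arc_b u.
    by case: up => [?|/arc_RE/andP[? ?]]; case: uq => [?|/arc_LE/andP[? ?]]; lia.
  + apply: paF; split; first by lia.
    by exists k, p0, (arc_a u - t); split=> //; [rewrite subrK | right].
  + have jqa : j q (arc_a u).
      have := jR _ Ra; rewrite -(tito_shift_mul _ _ _ k) -/t subrK => jaa.
      apply: tito_trans jaa; rewrite eq tito_shift_mul.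
      by case: uq => [->//|/jL jqb]; exact: tito_trans jba.
    have /andP[t_lt0 _] := arc_RE Ra.
    case: qb => [qb|/TCj jbq].
      by case: uq => [?|/arc_LE/andP[? ?]]; lia.
    apply: (between q) => //; rewrite aq /=.
    by case: uq => [?|/arc_LE/andP[? ?]]; lia.
Qed.

(** * Missing inversions and lower covers *)

Lemma exists_fit_not_inversion {n : nat} (x w : TITO n) :
  ~ (x <= w)%O ->
  exists u, fits u x /\ ~ inversion w (arc_a u) (arc_b u).
Proof.
move=> xw; have {xw} [a [b [xab wab]]] : exists a b, inversion x a b /\ ~ inversion w a b.
  apply: contrapT => H; apply: xw; apply/le_inversion => a b xab.
  by apply: contrapT => wab; apply: H; exists a, b.
(* Induction on a bound for [b - a] replaces the choice of a shortest missing inversion. *)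
have [m] : exists m : nat, b - a <= m%:Z by exists `|b - a|%N; lia.
elim: m a b xab wab => [|m IHm] a b xab wab abm; first by case: xab; lia.
(* Inversions of [w] compose, so such an [e] leaves [(a, e)] or [(e, b)] missing from [w]. Without
   one, each point in the interval precedes [b] or follows [a]. *)
have [[e [/andP[ae eb] xbe xea]]|noe] := pselect (exists e, [/\ a < e < b, x b e & x e a]).
  have [wae|wae] := pselect (inversion w a e); last by apply: (IHm a e) => //; lia.
  by apply: (IHm e b) => //; [move=> web; apply/wab/inversion_trans/web | lia].
have [ab xba] := xab.
pose L := [set e | a < e < b /\ x e b]; pose R := [set e | a < e < b /\ x a e].
have disj : L `&` R = set0.
  apply/seteqP; split=> // e [[_ xeb] [_ xae]].
  exact: (tito_cycle (tito_trans xae xeb) xba).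
have cover : L `|` R = [set c | a < c < b].
  apply/seteqP; split=> [e [[]//|[]//]|e /= /andP[ae eb]].
  have [xeb|xeb] := boolP (x e b); first by left; rewrite /L /= ae eb.
  right; rewrite /R /= ae eb; split=> //; apply: contrapT => xae; apply: noe; exists e.
  rewrite ae eb; split=> //.
    by have := tito_total x (negbT (lt_eqF eb)); rewrite (negbTE xeb).
  by have := tito_total x (negbT (lt_eqF ae)); move/negP/negbTE: xae => ->.
exists (Arc ab disj cover); split=> //; split=> //= e; by case.
Qed.

Lemma lower_arc_inversion {n : nat} (x : TITO n) (u : arc) :
  lower_arc x u -> inversion x (arc_a u) (arc_b u).
Proof. by move=> [xba _ _ _]; split=> //; exact: arc_lt. Qed.

Lemma lower_cover_arc {n : nat} (x w : TITO n) :
  covered_by w x ->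
  exists2 u, lower_arc x u & ~ inversion w (arc_a u) (arc_b u).
Proof.
move=> [wx wcov]; have /exists_fit_not_inversion[u [ux wab]] : ~ (x <= w)%O.
  by rewrite (lt_geF wx).
exists u => //; apply/lower_arcE; split=> //.
have [j uj _] := exists_minimal_fit ux.
have jx := uj.2 _ ux.
have [jba jadj _ _] := minimal_fit_lower_arc uj.
have ab := arc_lt u.
have [s [ws sx] _] := exists_sup [set w; j].
(* The join is not [w], as [j] inverts the endpoints of [u]; since [x] covers [w], it must be
   [x]. *)
have es : s = x.
  have sx' : (s <= x)%O by apply: sx => _ [->|->] //; exact: ltW.
  apply: contrapT => /eqP sNx; apply: wcov; exists s.
  rewrite !lt_neqAle sNx sx' ws ?andbT; last by left.
  apply/eqP => e; apply: wab; rewrite e.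
  by have /le_inversion := ws j (or_intror erefl); apply; split.
subst s; have xTC p q : inversion x p q ->
    clos_trans int (join_inversion [set w; j]) p q.
  exact: sup_inversion.
have TCi p q : clos_trans int (join_inversion [set w; j]) p q -> inversion x p q.
  apply: clos_trans_inversion => {}p {}q [y Xy].
  by have /le_inversion := ws y Xy; apply.
have TCx p q : clos_trans int (join_inversion [set w; j]) p q -> x q p.
  by move=> /TCi[].
have xwN p q : p < q -> x p q -> w p q by move=> pq; exact: tito_le_mono (ltW wx) pq.
have xjN p q : p < q -> x p q -> j p q by exact: tito_le_mono.
have between c : arc_a u < c < arc_b u -> x (arc_b u) c -> x c (arc_a u) -> False.
  have [_ xL xR] := ux.
  by move=> /arc_LR[/xL cb bc _|/xR ac _]; [exact: tito_cycle bc | exact: tito_cycle ac].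
split; first by case: ux.
move=> [e [xbe xea]]; have [eb|be|?] := ltgtP e (arc_b u); last first.
- by subst e; move: xbe; rewrite tito_irr.
- have /xTC/clos_trans_jump : inversion x (arc_a u) e by split=> //; lia.
  move=> /(_ (arc_b u)); rewrite be ltW// => -[//|p [q [pq /andP[pb bq] ap qe]]].
  have xbq : x (arc_b u) q.
    by case: qe => [->//|/TCx]; exact: tito_trans.
  (* Otherwise [p] is [b] or lies strictly between [a] and [b], and in [x] it comes after [b] and
     before [a]. *)
  have pa : p = arc_a u.
    case: ap => [//|/[dup] ap /TCx xpa]; exfalso.
    have xbp : x (arc_b u) p := tito_trans xbq (TCx _ _ (t_step _ _ _ _ pq)).
    have [pb'|pb'] : p = arc_b u \/ p < arc_b u by lia.
      by move: xbp; rewrite pb' tito_irr.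
    apply: (between p) => //; rewrite pb' andbT.
    by case: (TCi _ _ ap).
  (* If [w] inverts [(a, q)], it also inverts [(a, b)], since it keeps [b] before [q]; if [j] does,
     [q] separates [b] from [a] in [j]. *)
  subst p; case: pq => y [] -> [aq yqa].
    by apply: wab; split=> //; exact: tito_trans (xwN _ _ bq xbq) yqa.
  by apply: jadj; exists q; split=> //; exact: xjN.
- have [ea|ae|?] := ltgtP e (arc_a u); last first.
  + by subst e; move: xea; rewrite tito_irr.
  + by apply: (between e) => //; rewrite ae.
  have /xTC/clos_trans_jump : inversion x e (arc_b u).
    by split; [lia | exact: xbe].
  move=> /(_ (arc_a u - 1)) [|p [q [pq /andP[pa aq] ep qb]]]; first by lia.
  have {}pa : p < arc_a u by lia.
  have xpa : x p (arc_a u).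
    by case: ep => [->//|/TCx xpe]; exact: tito_trans xea.
  have eqb : q = arc_b u.
    case: qb => [//|/[dup] qb /TCx xbq]; exfalso.
    have xqa : x q (arc_a u) := tito_trans (TCx _ _ (t_step _ _ _ _ pq)) xpa.
    have [qa|qa] : q = arc_a u \/ arc_a u < q by lia.
      by move: xqa; rewrite qa tito_irr.
    apply: (between q) => //; rewrite qa /=.
    by case: (TCi _ _ qb).
  subst q; case: pq => y [] -> [pb ybp].
    by apply: wab; split=> //; exact: tito_trans ybp (xwN _ _ pa xpa).
  by apply: jadj; exists p; split=> //; exact: xjN.
Qed.

(** * Lower arcs and complete join-irreducibles *)

Lemma sup_lower_arc {n : nat} (x : TITO n) (u : arc) (V : set (TITO n)) :
  lower_arc x u -> supremums V x ->
  exists2 v, V v & inversion v (arc_a u) (arc_b u).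
Proof.
move=> xu Vx; have /lower_arcE[_ adj] := xu.
have := sup_inversion Vx (lower_arc_inversion xu).
move=> /(clos_trans_adjacent _ adj); apply => p q [v Vv].
by have /le_inversion := Vx.1 _ Vv; apply.
Qed.

(** A joinand inverting the endpoints fits [u], hence is [j] itself. *)
Lemma minimal_fit_cji (u : arc) {n : nat} (j : TITO n) :
  minimal_fit u j -> complete_join_irreducible j.
Proof.
move=> uj [X nXj Xj].
have [v Xv vab] := sup_lower_arc (minimal_fit_lower_arc uj) Xj.
have vj : (v <= j)%O by exact: Xj.1.
have /uj.2 jv := fits_le vj uj.1 vab.
by apply: nXj; rewrite (le_anti (introT andP (conj jv vj))).
Qed.

(* If [(a_u, b_u)] is adjacent in [x], then it can only be produced by the
   translate of [(a_v, b_v)] itself, so the two arcs have the same endpoints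
   modulo translation and each fits the minimal element of the other. *)
Lemma minimal_fit_eq {n : nat} (x j k : TITO n) (u v : arc) :
  lower_arc x u -> fits v x -> minimal_fit u j -> minimal_fit v k ->
  inversion k (arc_a u) (arc_b u) -> j = k.
Proof.
move=> xu vx uj vk kab; have /lower_arcE[ux adj] := xu.
have jk : (j <= k)%O by apply: uj.2; exact: fits_le (vk.2 _ vx) ux kab.
apply: le_anti; rewrite jk /=; apply: vk.2; apply: (fits_le (uj.2 _ ux) vx).
have step := clos_trans_adjacent (fun p q => arc_step_inversion vx) adj
  (minimal_fit_inversion vk kab).
case: step => _ [t [p0 [q0 [ea eb up uq]]]].
split; first exact: arc_lt.
have [xba xL xR] := vx.
have ep : p0 = arc_a v.
  case: up => // /xR xap; exfalso; apply: adj.2; exists (arc_a v + t * n%:Z).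
  rewrite ea eb !tito_shift_mul; split=> //.
  by case: uq => [->//|/xL xqb]; exact: tito_trans xba.
have eq : q0 = arc_b v.
  case: uq => // /xL xqb; exfalso; apply: adj.2; exists (arc_b v + t * n%:Z).
  by rewrite ea eb !tito_shift_mul ep.
rewrite -ep -eq -(tito_shift_mul _ _ _ t) -ea -eb.
by case: uj => -[].
Qed.

(* If [j] were not minimal, the join [w] of all y < j would be below it and
   would invert the endpoints of [u]; but an inversion of [j] missing from [w]
   and of minimal length spans an arc whose minimal fit is [j], and
   [minimal_fit_eq] makes it the minimal fit of [u] too. *)
Lemma cji_minimal_fit {n : nat} (j : TITO n) (u : arc) :
  complete_join_irreducible j -> lower_arc j u -> minimal_fit u j.
Proof.
move=> jirr ju; have /lower_arcE[uj _] := ju.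
have [k uk _] := exists_minimal_fit uj.
suff <- : k = j by [].
apply: contrapT => kNj.
have [w wsup _] := exists_sup [set y | (y < j)%O].
have [|v [vj wab]] := @exists_fit_not_inversion _ j w.
  move=> jw; apply: jirr; exists [set y | (y < j)%O]; first by rewrite /= ltxx.
  have wj : (w <= j)%O by apply: wsup.2 => y /ltW.
  have e : w = j by apply: le_anti; rewrite wj jw.
  by rewrite e in wsup.
have [m vm _] := exists_minimal_fit vj.
have mj : m = j.
  apply: contrapT => mNj; apply: wab.
  have /le_inversion : (m <= w)%O.
    by apply: wsup.1; rewrite /= lt_neqAle vm.2// andbT; apply/eqP.
  by apply; split; [exact: arc_lt | case: vm => -[]].
apply: kNj; rewrite -mj; apply: (minimal_fit_eq ju vj uk vm).
by rewrite mj; exact: lower_arc_inversion.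
Qed.

Lemma join_irr_of_minimal_fit {n : nat} (x : TITO n) (A : wrapped_arc n) (u : arc) :
  LowerArcs x A -> representatives A u -> minimal_fit u (join_irr_of A).
Proof.
move=> xA Au; have /wrapped_lower_arc_all/(_ u Au) xu := xA.
have /lower_arcE[ux _] := xu.
have [k uk _] := exists_minimal_fit ux.
(* The minimal fit [k] makes the set nonempty, so [xget] returns one of its members. *)
have [jirr jA] : [set j | complete_join_irreducible j /\ LowerArcs j A] (join_irr_of A).
  apply: xgetI; split; first exact: minimal_fit_cji uk.
  by exists u => //; exact: minimal_fit_lower_arc.
by apply: cji_minimal_fit => //; have /wrapped_lower_arc_all := jA; apply.
Qed.

Lemma lower_arc_wrapped {n : nat} (x : TITO n) (u : arc) :
  lower_arc x u -> exists2 A, LowerArcs x A & representatives A u.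
Proof.
move=> xu.
pose A := @WrappedPrearc n [set v | arc_equiv n u v] (ex_intro _ u erefl).
have Au : representatives A u by exact: rst_refl.
have xA : wrapped_lower_arc x A by exists u.
by exists (WrappedArc (wrapped_lower_arc_wrapped xA)).
Qed.

(** * Canonical join representations *)

Lemma lower_arcs_canonical_join_rep {n : nat} (x : TITO n) :
  widely_generated x ->
  canonical_join_rep x [set join_irr_of A | A in LowerArcs x].
Proof.
move=> xwide; set U := [set _ | _ in _].
have minU A : LowerArcs x A ->
    exists2 u, lower_arc x u & minimal_fit u (join_irr_of A).
  move=> /[dup] xA [u Au xu]; exists u => //.
  exact: (join_irr_of_minimal_fit xA Au).
have le_x A : LowerArcs x A -> (join_irr_of A <= x)%O.
  by move=> /minU[u /lower_arcE[ux _] uj]; exact: uj.2.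
split; first split.
- have [s sU _] := exists_sup U.
  have sx : (s <= x)%O by apply: sU.2 => _ [A xA <-]; exact: le_x.
  suff <- : s = x by [].
  apply: contrapT => /eqP sNx.
  (* A lower cover [w] above [s] misses the endpoints of some lower arc of [x], yet lies above the
     join-irreducible of that arc. *)
  have [|w wx sw] := xwide s; first by rewrite lt_neqAle sNx.
  have [u xu wab] := lower_cover_arc wx.
  have [A xA Au] := lower_arc_wrapped xu.
  have uj := join_irr_of_minimal_fit xA Au.
  have /le_inversion jw : (join_irr_of A <= w)%O.
    by apply: le_trans sw; apply: sU.1; exists A.
  exact/wab/jw/lower_arc_inversion/minimal_fit_lower_arc.
(* Some member of [U'] inverts the endpoints of the arc of [A]; being itself a minimal fit, it is
   [join_irr_of A]. *)
- move=> U' [U'U nUU'] U'x; apply: nUU' => _ [A xA <-].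
  have [u xu uj] := minU _ xA.
  have [v U'v vab] := sup_lower_arc xu U'x.
  have [B xB eB] := U'U _ U'v.
  have [t /lower_arcE[tx _] tj] := minU _ xB.
  suff -> : join_irr_of A = v by [].
  by rewrite -eB in vab *; exact: minimal_fit_eq xu tx uj tj vab.
- move=> V Vx _ [A xA <-]; have [u xu uj] := minU _ xA.
  have [v Vv vab] := sup_lower_arc xu Vx; exists v => //.
  have /lower_arcE[ux _] := xu.
  exact: uj.2 (fits_le (Vx.1 _ Vv) ux vab).
Qed.

(* For [u] in the canonical join representation of [x], the join of all
   [v <= x] with [~ u <= v] is a lower cover of [x]. *)
Lemma canonical_join_rep_widely_generated {d : Order.disp_t} {T : porderType d}
    (x : T) (U : set T) :
  (forall X : set T, exists s, supremums X s) ->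
  canonical_join_rep x U -> widely_generated x.
Proof.
move=> has_sup [[Ux Uirr] Umin] y yx.
have [u Uu uy] : exists2 u, U u & ~ (u <= y)%O.
  apply: contrapT => H; have : (x <= y)%O.
    by apply: Ux.2 => u Uu; apply: contrapT => uy; apply: H; exists u.
  by rewrite (lt_geF yx).
pose S := [set v | (v <= x)%O /\ ~ (u <= v)%O].
have [s sS] := has_sup S.
have sx : (s <= x)%O by apply: sS.2 => v [].
(* [U] is an antichain: an element below another could be dropped. *)
have Ule u' : U u' -> (u <= u')%O -> u' = u.
  move=> Uu' uu'; apply: contrapT => u'Nu; apply: (Uirr (U `\ u)).
    by split=> [v []//|/(_ u Uu)[_]]; apply.
  split=> [v [/Ux.1]//|z zU]; apply: Ux.2 => v Uv.
  have [->|vNu] := pselect (v = u); last by apply: zU.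
  by apply: le_trans uu' _; apply: zU.
exists s; last by apply: sS.1; split=> //; exact: ltW.
split=> [|[z /andP[sz zx]]].
  (* If [S] joined to [x], refinement would put [u] below a member of [S]. *)
  rewrite lt_neqAle sx andbT; apply/eqP => es; rewrite es in sS.
  by have [v [_ uv] /uv] := Umin _ sS _ Uu.
have uz : (u <= z)%O.
  apply: contrapT => uz; have : (z <= s)%O by apply: sS.1; split=> //; exact: ltW.
  by rewrite (lt_geF sz).
suff : (x <= z)%O by rewrite (lt_geF zx).
apply: Ux.2 => v Uv; have [/(Ule _ Uv) ->//|uv] := pselect (u <= v)%O.
by apply: le_trans (ltW sz); apply: sS.1; split=> //; exact: Ux.1.
Qed.

Theorem theorem4p13 (n : nat) (n_gt0 : (0 < n)%N) (x : TITO n) :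
  ((exists U : set (TITO n), canonical_join_rep x U) <-> widely_generated x) /\
  (widely_generated x ->
    canonical_join_rep x [set join_irr_of A | A in LowerArcs x]).
Proof.
split; last exact: lower_arcs_canonical_join_rep.
split=> [[U]|xwide].
  by apply: canonical_join_rep_widely_generated => X; have [s ? _] := exists_sup X; exists s.
by exists [set join_irr_of A | A in LowerArcs x]; exact: lower_arcs_canonical_join_rep.
Qed.
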